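(* Assume that the Cantor space $2^\omega$ cannot be covered by $\aleph_1$ meager sets, and that there is a Michael space. Then every productively Lindelöf $\aleph_1$-analytic subset of the Cantor space (with the subspace topology) is $\sigma$-compact.
   Context: For an uncountable cardinal $\kappa$, a $T_2$ space is $\kappa$-analytic if it is a continuous image of the product of $\aleph_0$ copies of the discrete space of cardinality $\kappa$. A topological space is productively Lindelöf if its product with every Lindelöf space is Lindelöf. A Michael space is a Lindelöf space $M$ such that $M\times\mathbb{P}$ is not Lindelöf, where $\mathbb{P}$ is the space of irrational numbers. *)

(* Defs.v *)
From HB Require Import structures.
From mathcomp Require Import all_boot all_order all_algebra.
From mathcomp Require Import all_classical all_reals all_analysis.
From mathcomp Require Import Rstruct Rstruct_topology.
From Stdlib Require Import Rdefinitions.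
Set Implicit Arguments. Unset Strict Implicit. Unset Printing Implicit Defensive.
Import Order.TTheory GRing.Theory Num.Theory.
Local Open Scope classical_set_scope.

Definition lindelof {T : topologicalType} (A : set T) : Prop :=
  forall C : set (set T), (forall U, C U -> open U) -> A `<=` \bigcup_(U in C) U ->
    exists2 C' : set (set T), C' `<=` C /\ countable C' & A `<=` \bigcup_(U in C') U.

Definition productively_lindelof {T : topologicalType} (X : set T) : Prop :=
  forall Y : topologicalType, lindelof [set: Y] -> lindelof (X `*` [set: Y]).

Definition irrationals : set R := [set x : R | ~ exists q : rat, x = ratr q].

Definition michael_space (M : topologicalType) : Prop :=
  lindelof [set: M] /\ ~ lindelof ([set: M] `*` irrationals).

Definition has_card_aleph1 (D : Type) : Prop :=
  ~ countable [set: D] /\ forall A : set D, countable A \/ (A #= [set: D])%card.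

Definition nowhere_dense {T : topologicalType} (A : set T) : Prop :=
  interior (closure A) = set0.

Definition meager {T : topologicalType} (A : set T) : Prop :=
  exists F : nat -> set T, (forall n, nowhere_dense (F n)) /\ A `<=` \bigcup_n F n.

Definition aleph1_analytic {T : topologicalType} (X : set T) : Prop :=
  exists D : choiceType, has_card_aleph1 D /\
    exists f : prod_topology (fun _ : nat => discrete_topology D) -> T,
      continuous f /\ range f = X.

Definition sigma_compact {T : topologicalType} (X : set T) : Prop :=
  exists K : nat -> set T, (forall n, compact (K n)) /\ X = \bigcup_n K n.

(* Main.v *)
Require Import Defs.
From HB Require Import structures.
From mathcomp Require Import all_boot all_order all_algebra.
From mathcomp Require Import all_classical all_reals all_analysis.
From mathcomp Require Import Rstruct Rstruct_topology wochoice.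
From Stdlib Require Import Rdefinitions.
Set Implicit Arguments. Unset Strict Implicit. Unset Printing Implicit Defensive.
Import Order.TTheory GRing.Theory Num.Theory.
Local Open Scope classical_set_scope.

(** Let X be the image of D^nat under a continuous map f, with |D| = aleph_1.

    If X is not a union of aleph_1 compact sets, discard the union U of the basic
    open sets whose image is covered by aleph_1 compact subsets of X.  Around a
    point outside U, the closure of the image of any basic open set minus U has a
    point y outside X, and the first place where x differs from y is a locally
    constant function of x in X taking infinitely many values.  Iterating this
    yields a continuous surjection of X onto nat^nat, and composing it with an upper
    semicontinuous compact-valued map onto the irrationals shows that M x P is
    Lindelof whenever X x M is, contradicting the existence of a Michael space.

    If X is a union of aleph_1 compact sets, the category assumption, applied in the
    part of a compact K where K is nowhere locally covered by countably many of them,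
    shows that countably many of them cover K.  If X is not sigma-compact, choosing
    in X a point outside each countable stage gives an uncountable subset S of X with
    countable trace on every compact subset of X.  Then S together with the complement
    of X, the points of S being isolated, is a Lindelof space whose product with X is
    not Lindelof. *)

(** * An order with countable initial segments on a set of size aleph_1 *)

(** In a well-order [R] of [D], the set [P] of points with countable initial segment is uncountable,
    since otherwise the least point outside [P] would belong to it. Hence [P] has the size of [D],
    and [R] is pulled back along an injection of [D] into [P]. *)
Lemma aleph1_order (D : choiceType) : has_card_aleph1 D ->
  exists le : D -> D -> Prop,
    [/\ forall d e, le d e \/ le e d,
        forall a b c, le a b -> le b c -> le a c
      & forall d, countable [set e | le e d]].
Proof.
move=> [ncD cardD].
have [R woR] := @well_ordering_principle D.
have wocR : wo_chain R predT by move=> A _; exact: woR.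
have Rtot a b : R a b || R b a by apply: (wo_chainW wocR).
have Ranti a b : R a b -> R b a -> a = b.
  by move=> ab ba; apply: (wo_chain_antisymmetric wocR) => //; rewrite ab ba.
have Rmin (P : D -> Prop) d : P d -> exists2 m, P m & forall e, P e -> R m e.
  move=> Pd; have [|m [[/asboolP Pm lbm] _]] := woR [pred x | `[< P x >]].
    by exists d; apply/asboolP.
  by exists m => // e Pe; apply: lbm; apply/asboolP.
have Rtrans a b c : R a b -> R b c -> R a c.
  move=> ab bc.
  have [m mabc Rm] := Rmin [set` [:: a; b; c]] a (mem_head _ _).
  have /= Ha := Rm a; have /= Hb := Rm b; have /= Hc := Rm c.
  rewrite !inE !eqxx ?orbT /= in Ha Hb Hc.
  have {}Ha := Ha isT; have {}Hb := Hb isT; have {}Hc := Hc isT.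
  move: mabc; rewrite /= !inE => /or3P[] /eqP me; move: Ha Hb Hc; rewrite me //.
  - by move=> ba _ _; rewrite (Ranti a b).
  - by move=> ca cb _; rewrite -(Ranti b c).
pose P := [set d | countable [set e | R e d]].
have ncP : ~ countable P.
  move=> cP; have [d nPd] : exists d, ~ P d.
    apply: contrapT => /forallNP allP; apply: ncD.
    rewrite (_ : [set: D] = P) // eqEsubset; split=> // d _.
    exact: contrapT (allP d).
  have [m nPm mmin] := Rmin (fun d => ~ P d) d nPd.
  apply: nPm; apply: (@sub_countable _ _ _ (P `|` [set m])); last first.
    rewrite -bigcup2E; apply: bigcup_countable => // -[|[|i]] _ //=.
  apply: subset_card_le => e /= em; have [|nPe] := pselect (P e); first by left.
  by right; apply: Ranti => //; exact: mmin.
have [//|PD] := cardD P.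
have : ([set: D] #<= P)%card by rewrite -(card_le_eql PD).
case/card_leP => g.
pose h d := val (g (to_setT d)) : D.
have hP d : P (h d) by exact: set_valP.
have hinj : injective h.
  move=> d e /val_inj /(@inj _ _ setT g); rewrite !inE => /(_ Logic.I Logic.I) /(congr1 val).
  by [].
exists (fun d e => R (h d) (h e)); split.
- by move=> d e; apply/orP; exact: Rtot.
- by move=> a b c; exact: Rtrans.
- move=> d; have /countable_injP[k kinj] := hP d.
  apply/countable_injP; exists (k \o h) => a b; rewrite !inE /= => ha hb /kinj.
  by rewrite !inE => /(_ ha hb)/hinj.
Qed.

(** * Neighbourhoods in sequence spaces through prefixes *)

Definition agree (A : Type) (n : nat) (x y : nat -> A) :=
  forall i, (i < n)%N -> x i = y i.

Lemma nbhs_prefix (A : discreteTopologicalType)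
    (x : prod_topology (fun _ : nat => A)) (U : set (prod_topology (fun _ : nat => A))) :
  nbhs x U <-> exists n, forall y, agree n x y -> U y.
Proof.
split=> [|[n nU]]; last first.
  have nF : Filter (nbhs x) := nbhs_filter x.
  suff : nbhs x [set y | agree n x y] by apply: filterS.
  elim: n {nU} => [|n IH]; first by apply: filterS filterT => y _ i.
  have : nbhs x [set y | x n = y n].
    apply: (@proj_continuous _ (fun=> A) n x [set a | x n = a]).
    by rewrite nbhs_principalE /principal_filter /=; apply/principal_filterP.
  apply: filterS2 IH => y yn ye i; rewrite ltnS leq_eqVlt => /orP[/eqP->//|].
  exact: yn.
pose F := filter_from [set: nat] (fun n => [set y | agree n x y] : set (prod_topology (fun _ : nat => A))).
have FF : Filter F.
  apply: filter_from_filter; first by exists 0%N.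
  move=> m n _ _; exists (maxn m n) => // y /= xy.
  split=> i im; apply: xy; rewrite leq_max im ?orbT //.
have Fx : F --> x.
  apply/cvg_sup => i W [_ [[V oV <-] Vx VW]].
  by exists i.+1 => // y xy; apply: VW; rewrite /= -xy.
by move=> /Fx[n _ nU]; exists n.
Qed.

Lemma nbhs_cantor (x : cantor_space) (U : set cantor_space) :
  nbhs x U <-> exists n, forall y : cantor_space, agree n x y -> U y.
Proof. exact: (@nbhs_prefix bool). Qed.

(** * Countable subcovers of compact subsets of the Cantor space *)

Section countable_subcover.
Variables (D : Type) (K : set cantor_space) (F : D -> nat -> set cantor_space).

Definition countably_covered (A : set cantor_space) :=
  exists2 C : set D, countable C &
    forall x, A x -> exists d n, C d /\ F d n x.

Lemma countably_covered_bigcup (I : countType) (P : set I) (A : I -> set cantor_space) :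
  (forall i, P i -> countably_covered (A i)) ->
  countably_covered (\bigcup_(i in P) A i).
Proof.
move=> cA.
have /choice[C HC] : forall i, exists C : set D, countable C /\
    (P i -> forall x, A i x -> exists d n, C d /\ F d n x).
  move=> i; have [/cA[C cC CA]|nP] := pselect (P i); first by exists C.
  by exists set0.
exists (\bigcup_(i in P) C i).
  by apply: bigcup_countable => // i _; case: (HC i).
move=> x [i Pi Aix]; have [d [n [Cd Fx]]] := (HC i).2 Pi x Aix.
by exists d, n; split => //; exists i.
Qed.

Lemma countably_coveredS (A B : set cantor_space) :
  A `<=` B -> countably_covered B -> countably_covered A.
Proof. by move=> AB [C cC CB]; exists C => // x /AB/CB. Qed.

Definition cylinder (t : seq bool) : set cantor_space :=
  [set x | forall i, (i < size t)%N -> x i = nth false t i].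

Definition large (t : seq bool) := ~ countably_covered (K `&` cylinder t).

Lemma large_rcons t b : large t -> ~ large (rcons t b) -> large (rcons t (~~ b)).
Proof.
move=> lt /contrapT sb snb; apply: lt.
apply: (@countably_coveredS _ (\bigcup_(c in [set: bool]) (K `&` cylinder (rcons t c)))).
  move=> x [Kx tx]; exists (x (size t)) => //; split => // i.
  rewrite size_rcons ltnS nth_rcons leq_eqVlt => /orP[/eqP->|it].
    by rewrite ltnn eqxx.
  by rewrite it tx.
apply: countably_covered_bigcup => c _.
by have [->//|/negPf cb] := eqVneq c b; rewrite (_ : c = ~~ b) //; case: (c) (b) cb => [] [].
Qed.

(** The path obeys [b] while this keeps the word large and otherwise turns to the other child, which
    is then large. It thus never leaves the tree of large words, provided the empty word is
    large. *)
Fixpoint steer (b : nat -> bool) (n : nat) : seq bool :=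
  if n is m.+1 then
    let t := steer b m in
    rcons t (if `[< large (rcons t (b m)) >] then b m else ~~ b m)
  else [::].

Lemma size_steer b n : size (steer b n) = n.
Proof. by elim: n => //= n IH; rewrite size_rcons IH. Qed.

Lemma eq_steer n b c : agree n b c -> steer b n = steer c n.
Proof.
elim: n => //= n IH bc; rewrite (IH _) ?(bc n)// => i it; apply: bc.
exact: ltnW.
Qed.

Definition steered (b : nat -> bool) : cantor_space := fun n => nth false (steer b n.+1) n.

Lemma nth_steer b n i : (i < n)%N -> nth false (steer b n) i = steered b i.
Proof.
elim: n => // n IH; rewrite ltnS leq_eqVlt => /orP[/eqP->//|it].
by rewrite /= nth_rcons size_steer it IH.
Qed.

Lemma cylinder_steer b n x : cylinder (steer b n) x <-> agree n (steered b) x.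
Proof.
split=> H i; first by move=> it; rewrite H ?size_steer// nth_steer.
by rewrite size_steer => it; rewrite -H// nth_steer.
Qed.

Lemma steered_agree n b c : agree n b c -> agree n (steered b) (steered c).
Proof. by move=> /eq_steer e i it; rewrite -!(@nth_steer _ n)// e. Qed.

Lemma large_steer b n : ~ countably_covered K -> large (steer b n).
Proof.
move=> lK; elim: n => [|n IH] /=.
  by move=> c; apply: lK; apply: countably_coveredS c => x Kx; split.
by case: asboolP => // /(large_rcons IH).
Qed.

Lemma steered_in b : closed K -> ~ countably_covered K -> K (steered b).
Proof.
move=> cK lK; apply: cK => U /nbhs_cantor[n nU].
have [x [Kx /cylinder_steer bx]] : K `&` cylinder (steer b n) !=set0.
  apply/set0P/eqP => e; have := @large_steer b n lK; apply; rewrite e.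
  by exists set0.
by exists x; split => //; exact: nU.
Qed.

(** Take [b] equal to [c] below [n] and to [x] from there on: as all prefixes of [x] are large, the
    steering obeys [b] from [n] on and traces [x]. *)
Lemma steered_onto c n x : K x -> agree n (steered c) x ->
  (forall s, cylinder s x -> large s) ->
  exists2 b, agree n c b & steered b = x.
Proof.
move=> Kx cx lx; pose b i := if (i < n)%N then c i else x i.
have cb : agree n c b by move=> i it; rewrite /b it.
exists b => //.
have main k : (n <= k)%N -> agree k (steered b) x.
  elim: k => [|k IH]; first by move=> _ i.
  rewrite leq_eqVlt => /orP[/eqP <- i it|].
    by rewrite -(steered_agree cb it) cx.
  rewrite ltnS => nk i; rewrite ltnS leq_eqVlt => /orP[/eqP->|]; last exact: IH.
  rewrite /steered /= nth_rcons size_steer ltnn eqxx.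
  have bk : b k = x k by rewrite /b ltnNge nk.
  rewrite asboolT ?bk//; apply: lx => j.
  rewrite size_rcons size_steer ltnS nth_rcons size_steer leq_eqVlt => /orP[/eqP->|jk].
    by rewrite ltnn eqxx.
  by rewrite jk nth_steer// IH.
apply/funext => i; apply: (main (maxn n i.+1)); first exact: leq_maxl.
by rewrite leq_max leqnn orbT.
Qed.

Hypothesis not_covered : forall G : D -> set cantor_space,
  (forall d, meager (G d)) -> \bigcup_(d in [set: D]) G d <> [set: cantor_space].

(* [steered] retracts the Cantor space onto the part of [K] where no neighbourhood
   is countably covered, and it maps cylinders onto traces of cylinders. *)
Lemma closed_countably_covered : closed K ->
  (forall d n, closed (F d n)) -> (forall x, K x -> exists d n, F d n x) ->
  countably_covered K.
Proof.
move=> cK cF KF; apply: contrapT => lK.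
(* The preimages of the sets [F d n] under [steered] cover the Cantor space, so by the category
   hypothesis one of them is dense in some cylinder; being closed, it contains that cylinder. *)
have [d [n nnd]] : exists d n, ~ nowhere_dense [set b : cantor_space | F d n (steered b)].
  apply: contrapT => all_nd.
  apply: (not_covered (G := fun d => \bigcup_n [set b : cantor_space | F d n (steered b)])).
    move=> d; exists (fun n => [set b : cantor_space | F d n (steered b)]); split => // n.
    by apply: contrapT => nnd; apply: all_nd; exists d, n.
  rewrite eqEsubset; split=> // b _.
  by have [d [n Fb]] := KF _ (steered_in b cK lK); exists d => //; exists n.
have [c /nbhs_cantor[m mc]] :
    interior (closure [set b : cantor_space | F d n (steered b)]) !=set0.
  by apply/set0P/eqP.
have {mc}Fc b : agree m c b -> F d n (steered b).
  move=> /mc bcl; apply: cF => U /nbhs_cantor[k kU].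
  have [|b' [Fb' bb']] := bcl [set b' : cantor_space | agree k b b'].
    by apply/nbhs_cantor; exists k.
  by exists (steered b'); split => //; apply: kU; exact: steered_agree.
apply: (@large_steer c m lK).
(* The trace of [K] on the large cylinder is covered by the countably many traces that are countably
   covered and by the single set [F d n], encoded as [None]. *)
pose A (o : option (seq bool)) := if o is Some s then K `&` cylinder s else F d n.
apply: (@countably_coveredS _ (\bigcup_(o in [set o | if o is Some s then ~ large s else True]) A o)).
  move=> x [Kx /cylinder_steer cx].
  have [[s [xs ls]]|nex] := pselect (exists s, cylinder s x /\ ~ large s).
    by exists (Some s).
  have [|b cb <-] := @steered_onto c m x Kx cx.
    by move=> s xs; apply: contrapT => ls; apply: nex; exists s.
  by exists None => //; exact: Fc.
apply: countably_covered_bigcup => -[s /contrapT//|_] /=.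
by exists [set d]; [exact: countable1|move=> x Fx; exists d, n].
Qed.

End countable_subcover.

(** * A space of Michael-line type *)

Definition michael_line (X S : set cantor_space) : Type := {p : cantor_space | S p \/ ~ X p}.

Section michael_line.
Variables (X S : set cantor_space).
Local Notation Y := (michael_line X S).

HB.instance Definition _ := gen_eqMixin Y.
HB.instance Definition _ := gen_choiceMixin Y.

Definition michael_open : set (set Y) := [set U | forall p, U p -> ~ S (sval p) ->
  exists n, forall q, agree n (sval p) (sval q) -> U q].

Lemma michael_openT : michael_open setT.
Proof. by move=> p _ _; exists 0%N. Qed.

Lemma michael_openI : setI_closed michael_open.
Proof.
move=> U V oU oV p [Up Vp] nS.
have [n nU] := oU p Up nS; have [m mV] := oV p Vp nS.
exists (maxn n m) => q pq; split; [apply: nU|apply: mV] => i im; apply: pq.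
  by rewrite leq_max im.
by rewrite leq_max im orbT.
Qed.

Lemma michael_open_bigcup (I : Type) (f : I -> set Y) :
  (forall i, michael_open (f i)) -> michael_open (\bigcup_i f i).
Proof.
move=> fo p [i _ fp] nS; have [n nf] := fo i p fp nS.
by exists n => q /nf fq; exists i.
Qed.

HB.instance Definition _ :=
  isOpenTopological.Build Y michael_openT michael_openI michael_open_bigcup.

Lemma michael_line_openE (U : set Y) : open U = michael_open U.
Proof. by []. Qed.

Lemma cylinder_mkseq (x : cantor_space) n y : cylinder (mkseq x n) y <-> agree n x y.
Proof.
split=> H i; first by move=> it; rewrite H ?size_mkseq// nth_mkseq.
by rewrite size_mkseq => it; rewrite -H// nth_mkseq.
Qed.

(** The words whose cylinder lies in one member of the cover are countably many. The points in none
    of these cylinders form a compact set, contained in [X] because points outside [X] keep their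
    Cantor neighbourhoods; so only countably many points of [S] remain. *)
Lemma lindelof_michael_line : S `<=` X ->
  (forall K, compact K -> K `<=` X -> countable (K `&` S)) -> lindelof [set: Y].
Proof.
move=> SX SK C Co CT.
pose P t := exists2 U, C U & forall q : Y, cylinder t (sval q) -> U q.
pose K := [set x | forall t, cylinder t x -> ~ P t].
have cK : compact K.
  apply: (subclosed_compact _ cantor_space_compact) => // x xK t tx Pt.
  have [|y [Ky ty]] := xK (cylinder t).
    apply/nbhs_cantor; exists (size t) => y xy i it.
    by rewrite -xy// tx.
  exact: Ky t ty Pt.
have KX : K `<=` X.
  move=> x Kx; apply: contrapT => nX.
  have nS : ~ S x by move=> /SX.
  pose p : Y := exist _ x (or_intror nX).
  have [U CU Up] := CT p Logic.I.
  have := Co U CU; rewrite michael_line_openE => /(_ p Up nS)[n nU].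
  apply: (Kx (mkseq x n)); first exact/cylinder_mkseq.
  by exists U => // q /cylinder_mkseq; exact: nU.
have cKS := SK K cK KX.
have /choice[u Hu] : forall t, exists U, P t -> C U /\ forall q : Y, cylinder t (sval q) -> U q.
  move=> t; have [[U CU tU]|nP] := pselect (P t); first by exists U.
  by exists setT.
have /choice[v Hv] : forall q : Y, exists U, C U /\ U q.
  by move=> q; have [U CU Uq] := CT q Logic.I; exists U.
exists (u @` P `|` v @` [set q | (K `&` S) (sval q)]).
  split.
    by move=> _ [[t /Hu[? _] <-]|[q _ <-]] //; case: (Hv q).
  rewrite -bigcup2E; apply: bigcup_countable => // -[|[|i]] _ //=.
    exact: (sub_countable (card_image_le _ _)).
  apply: (sub_countable (card_image_le _ _)).
  have /countable_injP[k kinj] := cKS.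
  apply/countable_injP; exists (k \o sval) => a b; rewrite !inE /= => Ka Kb.
  by move=> /kinj; rewrite !inE => /(_ Ka Kb); case: a b {Ka Kb} => [a ?] [b ?] /= ?; exact: eq_exist.
move=> q _; have [[t [tq Pt]]|nt] := pselect (exists t, cylinder t (sval q) /\ P t).
  by exists (u t); [left; exists t|have [_] := Hu t Pt; apply].
have Kq : K (sval q) by move=> t tq Pt; apply: nt; exists t.
exists (v q); last by case: (Hv q).
right; exists q => //; split => //.
by case: (svalP q) => // /(_ (KX _ Kq)).
Qed.

(** The complement of the diagonal and the slices over the isolated points cover the product, but a
    diagonal point over [S] lies in its own slice only. *)
Lemma michael_line_not_lindelof : S `<=` X -> ~ countable S ->
  ~ lindelof (X `*` [set: Y]).
Proof.
move=> SX ncS lXY.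
pose G (q : Y) : set (cantor_space * Y) := [set z | z.2 = q].
pose Ginf : set (cantor_space * Y) := [set z | z.1 <> sval z.2].
have [U [Uo|[q Sq ->]]| |C' [C'C cC'] cov] :=
  lXY [set U | U = Ginf \/ exists2 q, S (sval q) & U = G q].
- rewrite Uo openE => -[x q] /= xq.
  have [i xqi] : exists i, x i <> sval q i.
    by apply: contrapT => /forallNP e; apply: xq; apply/funext => i; exact: contrapT (e i).
  exists ([set y | y i = x i], [set p | sval p i = sval q i]) => /=; last first.
    move=> [y p] [/= yi qi] yp; apply: xqi; rewrite -yi -qi.
    exact: (congr1 (fun f : cantor_space => f i) yp).
  split; first by apply/nbhs_cantor; exists i.+1 => y xy; rewrite xy.
  apply: open_nbhs_nbhs; split => //; rewrite michael_line_openE => p /= pi _.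
  by exists i.+1 => p' pp; rewrite -pp.
- rewrite openE => -[x p] xpq; have {xpq}-> : p = q by [].
  exists (setT, [set q]) => /=; last by move=> [y p'] [].
  split; first exact: filterT.
  by apply: open_nbhs_nbhs; split => //; rewrite michael_line_openE => p' ->.
- move=> [x q] [Xx _]; have [xq|xq] := pselect (x = sval q); last by exists Ginf => //; left.
  exists (G q) => //; right; exists q => //.
  by case: (svalP q) => // nX; move: Xx; rewrite xq.
have C'G q : S (sval q) -> C' (G q).
  move=> Sq; have [//=|U C'U] := cov (sval q, q); first by split=> //; exact: SX.
  have [->//|[q' _ Uq']] := C'C _ C'U.
    rewrite Uq' => qq'; have -> : q = q' by []. by rewrite -Uq'.
have /countable_injP[k kinj] := cC'.
apply: ncS; apply: (@sub_countable _ _ _ (sval @` [set q : Y | S (sval q)])).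
  by apply: subset_card_le => x Sx; exists (exist _ x (or_introl Sx)).
apply: (sub_countable (card_image_le _ _)).
apply/countable_injP; exists (k \o G) => p q; rewrite !inE /= => Sp Sq /kinj.
rewrite !inE => /(_ (C'G _ Sp) (C'G _ Sq)) e.
have : G p (point, p) by [].
by rewrite e.
Qed.

End michael_line.

(** * Sets that are unions of aleph_1 compact sets *)

Lemma countable_enum T (A : set T) : countable A ->
  exists e : nat -> option T, forall a, A a -> exists n, e n = Some a.
Proof.
move=> /countable_injP[k kinj].
have /choice[e He] : forall n, exists o, forall a, A a -> k a = n -> o = Some a.
  move=> n; have [[a [Aa an]]|na] := pselect (exists a, A a /\ k a = n).
    exists (Some a) => b Ab bn; congr Some; apply: kinj; rewrite ?inE//.
    by rewrite an bn.
  by exists None => a Aa an; case: na; exists a.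
by exists e => a Aa; exists (k a); exact: He.
Qed.

Lemma sigma_compact_countable (T : topologicalType) (X : set T) (I : countType) (K : I -> set T) :
  (forall i, compact (K i)) -> X = \bigcup_i K i -> sigma_compact X.
Proof.
move=> cK ->; exists (fun n => if choice.unpickle n is Some i then K i else set0); split.
  by move=> n; case: choice.unpickle => // ; exact: compact0.
rewrite eqEsubset; split=> x [i _].
  by move=> Kx; exists (choice.pickle i) => //; rewrite choice.pickleK.
by case: choice.unpickle => // j Kx; exists j.
Qed.

Section aleph1_compact_cover.
Variables (D : Type) (le : D -> D -> Prop).
Hypothesis le_total : forall d e, le d e \/ le e d.
Hypothesis le_countable : forall d, countable [set e | le e d].
Hypothesis uncountableD : ~ countable [set: D].
Hypothesis not_covered : forall G : D -> set cantor_space,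
  (forall d, meager (G d)) -> \bigcup_(d in [set: D]) G d <> [set: cantor_space].

Lemma aleph1_compact_sigma_compact (X : set cantor_space) (F : D -> nat -> set cantor_space) :
  productively_lindelof X ->
  (forall d n, compact (F d n)) -> (forall d n, F d n `<=` X) ->
  (forall x, X x -> exists d n, F d n x) -> sigma_compact X.
Proof.
move=> plX cF FX XF; apply: contrapT => nsX.
have clF d n : closed (F d n) := (compact_closed cantor_space_hausdorff (cF d n)).
(* If no such point existed for [d], the countably many compact sets with index below [d] would
   exhaust [X]. *)
have /choice[s Hs] : forall d, exists x, X x /\ forall e n, le e d -> ~ F e n x.
  move=> d; apply: contrapT => /forallNP nx; apply: nsX.
  have [e He] := countable_enum (le_countable d).
  pose K (i : nat * nat) := if e i.1 is Some a then F a i.2 else set0.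
  apply: (@sigma_compact_countable _ _ _ K).
    by rewrite /K => i; case: (e i.1) => //; exact: compact0.
  rewrite eqEsubset; split=> x; last first.
    by move=> [i _]; rewrite /K; case: (e i.1) => // a; exact: FX.
  move=> Xx; apply: contrapT => nK; apply: (nx x); split => // a n ad Fx.
  have [m em] := He a ad; apply: nK; exists (m, n) => //.
  by rewrite /K /= em.
(* Countably many indices [e] cover [K], and [s d] can lie in [F e n] only if [d] is below [e]. *)
have countK K : compact K -> K `<=` X -> countable [set d | K (s d)].
  move=> cK KX.
  have [C cC CK] : countably_covered F K.
    apply: closed_countably_covered => //.
      exact: (compact_closed cantor_space_hausdorff cK).
    by move=> x /KX/XF.
  apply: (@sub_countable _ _ _ (\bigcup_(e in C) [set d | le d e])); last exact: bigcup_countable.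
  apply: subset_card_le => d /= /CK[e [n [Ce Fs]]]; exists e => //=.
  by have [//|ed] := le_total d e; case: ((Hs d).2 e n ed).
pose S := range s.
have SX : S `<=` X by move=> _ [d _ <-]; case: (Hs d).
apply: (@michael_line_not_lindelof X S SX).
  move=> cS; apply: uncountableD.
  (* [s] may repeat values, but its fibres are countable by [countK] for singletons. *)
  apply: (@sub_countable _ _ _ (\bigcup_(x in S) [set d | s d = x])).
    by apply: subset_card_le => d _; exists (s d) => //; exists d.
  apply: bigcup_countable => // x Sx; apply: (countK [set x]); first exact: compact_set1.
  by move=> _ ->; exact: SX.
apply: plX; apply: lindelof_michael_line => // K cK KX.
apply: (@sub_countable _ _ _ (s @` [set d | K (s d)])).
  by apply: subset_card_le => x [Kx [d _ dx]]; exists d; rewrite //= dx.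
apply: (sub_countable (card_image_le _ _)); exact: countK.
Qed.

End aleph1_compact_cover.

(** * First differences of binary sequences *)

Definition split_at (n : nat) (x y : cantor_space) := agree n x y /\ x n <> y n.

Lemma split_at_uniq m n x y : split_at m x y -> split_at n x y -> m = n.
Proof.
move=> [xym dm] [xyn dn]; case: (ltngtP m n) => // mn.
  by case: dm; exact: xyn.
by case: dn; exact: xym.
Qed.

Lemma split_at_ex x y n : x <> y -> agree n x y -> exists2 m, (n <= m)%N & split_at m x y.
Proof.
move=> xy nxy.
have ex : exists m, x m != y m.
  apply: contrapT => /forallNP e; apply: xy; apply/funext => m.
  by apply/eqP; apply: contrapT => /negP; exact: e.
case: (ex_minnP ex) => m /eqP dm minm; exists m.
  by rewrite leqNgt; apply/negP => /nxy.
split => // i im; apply/eqP; apply: contraTT im => /minm; by rewrite leqNgt.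
Qed.

(** The default 0 is reached only for [x = y]. *)
Definition delta (x y : cantor_space) : nat := xget 0%N [set n | split_at n x y].

Lemma deltaP n x y : split_at n x y -> delta x y = n.
Proof.
by move=> xyn; apply: (@split_at_uniq _ _ x y) => //; exact: (@xgetPex _ 0%N [set n | split_at n x y] (ex_intro _ n xyn)).
Qed.

Lemma agree_split_at n x y x' : split_at n x y -> agree n.+1 x x' -> split_at n x' y.
Proof.
move=> [xy dn] xx'; split; last by rewrite -xx'.
by move=> i it; rewrite -xx' ?xy// ltnW.
Qed.

Lemma mkseq_agree (T : Type) n (x y : nat -> T) : mkseq x n = mkseq y n <-> agree n x y.
Proof.
split=> [e i it|xy].
  by have := congr1 (nth (x 0%N) ^~ i) e; rewrite !nth_mkseq.
by apply/eq_in_map => i; rewrite mem_iota => /andP[_]; exact: xy.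
Qed.

(** * A continuous surjection onto the Baire space *)

Section baire_quotient.
Variables (D : choiceType) (le : D -> D -> Prop).
Hypothesis le_total : forall d e, le d e \/ le e d.
Hypothesis le_trans : forall a b c, le a b -> le b c -> le a c.
Hypothesis le_countable : forall d, countable [set e | le e d].
Local Notation E := (prod_topology (fun _ : nat => discrete_topology D)).
Variable f : E -> cantor_space.
Hypothesis cf : continuous f.
Let X := range f.

Definition inner (F : D -> nat -> set cantor_space) :=
  forall d n, compact (F d n) /\ F d n `<=` X.

Definition small (s : seq D) := exists2 F, inner F &
  forall w : E, mkseq w (size s) = s -> exists d n, F d n (f w).

Let U : set E := [set w | exists n, small (mkseq w n)].

Lemma seq_bound d (s : seq D) : exists u, le d u /\ forall a, a \in s -> le a u.
Proof.
have le_refl a : le a a by case: (le_total a a).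
elim: s => [|b s [u [du su]]]; first by exists d.
have [bu|ub] := le_total b u.
  by exists u; split => // a; rewrite inE => /orP[/eqP->|/su].
exists b; split; first exact: le_trans ub.
move=> a; rewrite inE => /orP[/eqP->//|/su au]; exact: le_trans ub.
Qed.

Lemma countable_bounded u :
  countable [set p : seq D * nat | forall a, a \in p.1 -> le a u].
Proof.
have /countable_injP[k kinj] := le_countable u.
have minj (s t : seq D) : (forall a, a \in s -> le a u) ->
    (forall a, a \in t -> le a u) -> map k s = map k t -> s = t.
  elim: s t => [|a s IH] [|b t] //= sa tb [kab kst].
  rewrite (kinj a b) ?inE//; [|exact/sa/mem_head|exact/tb/mem_head].
  congr cons; apply: IH => // c cs; [apply: sa|apply: tb]; by rewrite inE cs orbT.
apply/countable_injP; exists (fun p => choice.pickle (map k p.1, p.2)).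
move=> [s i] [t j]; rewrite !inE /= => sb tb /(pcan_inj (@choice.pickleK _)) [st ->].
by rewrite (minj _ _ sb tb st).
Qed.

(* The sets attached to all the words s are reindexed by D x nat: only countably many
   triples (s, d, n) lie below a given u. *)
Lemma small_union : exists2 F, inner F & forall w, U w -> exists d n, F d n (f w).
Proof.
have /choice[G HG] : forall s, exists F, inner F /\ (small s ->
    forall w : E, mkseq w (size s) = s -> exists d n, F d n (f w)).
  move=> s; have [[F iF sF]|ns] := pselect (small s); first by exists F.
  by exists (fun _ _ => set0); split => // d n; split; [exact: compact0|].
have /choice[e He] := fun u => countable_enum (countable_bounded u).
(* The index [d] is stored as the head of the word, so one bound [u] controls it and the letters of
   [s]. *)
pose F u k := if e u k is Some (d :: s, n) then G s d n else set0.
exists F.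
  move=> u k; rewrite /F; case: (e u k) => [[[|d s] n]|].
  - by split; [exact: compact0|].
  - by case: (HG s) => + _; apply.
  - by split; [exact: compact0|].
move=> w [n sn]; have [_ /(_ sn w)[|d [i Gi]]] := HG (mkseq w n).
  by rewrite size_mkseq.
have [u [du su]] := seq_bound d (mkseq w n).
have [|k ek] := He u (d :: mkseq w n, i).
  by move=> a /=; rewrite inE => /orP[/eqP->|/su].
by exists u, k; rewrite /F ek.
Qed.

(** Otherwise the closure of the image of the points outside [U] that share the prefix of [z] is a
    compact subset of [X]. With the sets covering the image of [U] it makes that prefix small, so
    [z] would lie in [U]. *)
Lemma outer_limit (z : E) m : ~ U z -> exists y, ~ X y /\
  forall n, exists w, [/\ ~ U w, agree m z w & agree n (f w) y].
Proof.
move=> nUz; pose P := f @` [set w | ~ U w /\ agree m z w].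
have [y [Py nXy]] : exists y, closure P y /\ ~ X y.
  apply: contrapT => /forallNP PX; apply: nUz.
  have [F iF FU] := small_union.
  exists m; exists (fun d n => if n is k.+1 then F d k else closure P).
    move=> d [|n]; last exact: iF.
    split; last by move=> y Py; apply: contrapT => nX; apply: (PX y).
    by apply: (subclosed_compact _ cantor_space_compact) => //; exact: closed_closure.
  move=> w; rewrite size_mkseq => /mkseq_agree wz.
  have [/FU[d [n Fw]]|nUw] := pselect (U w); first by exists d, n.+1.
  (* [z 0] merely supplies some element of [D]; index 0 is the closure. *)
  exists (z 0%N), 0%N; apply: subset_closure; exists w => //; split => // i im.
  by rewrite wz.
exists y; split => // n.
have [|_ [[w [nUw zw] <-] yw]] := Py [set x : cantor_space | agree n y x].
  by apply/nbhs_cantor; exists n.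
by exists w; split => // i im; rewrite yw.
Qed.

Lemma infinite_label (V : set nat) : (forall n, exists2 m, (n <= m)%N & V m) ->
  exists lab : nat -> nat, forall k, exists2 n, V n & lab n = k.
Proof.
move=> Vinf; have : infinite_set V.
  move=> fV; have [n Vn] : exists n, forall m, V m -> (m < n)%N.
    have /finite_seqP[s ->] := fV; exists (\max_(i <- s) i).+1 => m ms.
    by rewrite ltnS; exact: leq_bigmax_seq.
  by have [m nm /Vn] := Vinf n; rewrite ltnNge nm.
move/infiniteP/card_leP => -[g].
pose h k := val (g (to_setT k)) : nat.
have hinj : injective h.
  by move=> i j /val_inj /(@inj _ _ setT g); rewrite !inE => /(_ Logic.I Logic.I) /(congr1 val).
have /choice[lab Hlab] : forall n, exists k, forall k', h k' = n -> k' = k.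
  move=> n; have [[k <-]|nk] := pselect (exists k, h k = n).
    by exists k => k' /hinj.
  by exists 0%N => k kn; case: nk; exists k.
exists lab => k; exists (h k); first exact: set_valP.
by rewrite -(Hlab _ k erefl).
Qed.

(** The first differences from the limit [y] are unbounded, so they can be labelled by all naturals.
    By continuity a long enough prefix of a chosen [w] fixes the difference; the prefix also exceeds
    [m], so that iterated prefixes converge. *)
Lemma splitting_node (z : E) m : ~ U z ->
  exists (y : cantor_space) (lab : nat -> nat) (child : nat -> E * nat),
  ~ X y /\ forall k, [/\ ~ U (child k).1, (m < (child k).2)%N, agree m z (child k).1 &
    forall w, agree (child k).2 (child k).1 w -> exists2 n, split_at n (f w) y & lab n = k].
Proof.
move=> /(@outer_limit z m)[y [nXy ylim]].
have [|lab Hlab] := @infinite_label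
    [set n | exists w, [/\ ~ U w, agree m z w & split_at n (f w) y]].
  move=> n; have [w [nUw zw wy]] := ylim n.
  have [|k nk kwy] := split_at_ex _ wy; first by move=> e; apply: nXy; exists w.
  by exists k => //; exists w.
have /choice[child Hchild] : forall k, exists c : E * nat,
    [/\ ~ U c.1, (m < c.2)%N, agree m z c.1 &
    forall w, agree c.2 c.1 w -> exists2 n, split_at n (f w) y & lab n = k].
  move=> k; have [n [w [nUw zw wy]] nk] := Hlab k.
  have /(@cf w)/nbhs_prefix[j wj] : nbhs (f w) [set x : cantor_space | agree n.+1 (f w) x].
    by apply/nbhs_cantor; exists n.+1.
  exists (w, maxn j m.+1); split => //=.
    by rewrite leq_maxr.
  move=> v wv; exists n => //; apply: (agree_split_at wy); apply: wj => i ij.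
  by apply: wv; rewrite leq_max ij.
by exists y, lab, child.
Qed.

(** [B x] lists the labels met by descending the tree of splitting nodes, where [x] selects the
    child at each node. Conversely, following the children prescribed by [b] gives growing prefixes,
    whose limit has an image with label sequence [b]. *)
Lemma baire_quotient :
  ~ (exists2 F, inner F & forall x, X x -> exists d n, F d n x) ->
  exists B : cantor_space -> nat -> nat,
    (forall x n, X x -> exists m, forall x', agree m x x' -> agree n (B x) (B x')) /\
    (forall b : nat -> nat, exists2 x, X x & B x = b).
Proof.
move=> nX; have [z0 nUz0] : exists z, ~ U z.
  apply: contrapT => /forallNP allU; apply: nX.
  have [F iF FU] := small_union; exists F => // _ [w _ <-].
  by apply: FU; exact: contrapT (allU w).
pose data := (cantor_space * (nat -> nat) * (nat -> E * nat))%type.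
have /choice[st Hst] : forall nu : E * nat, exists d : data, ~ U nu.1 ->
    ~ X d.1.1 /\ forall k, [/\ ~ U (d.2 k).1, (nu.2 < (d.2 k).2)%N, agree nu.2 nu.1 (d.2 k).1 &
    forall w, agree (d.2 k).2 (d.2 k).1 w ->
      exists2 n, split_at n (f w) d.1.1 & d.1.2 n = k].
  move=> [z m]; have [Uz|nUz] := pselect (U z).
    by exists (point, (fun=> 0%N), (fun=> (z, m))).
  have [y [lab [child H]]] := splitting_node m nUz.
  by exists (y, lab, child).
pose pt nu := (st nu).1.1; pose lab nu := (st nu).1.2; pose child nu := (st nu).2.
pose label x nu := lab nu (delta x (pt nu)).
pose node x n := iter n (fun nu => child nu (label x nu)) (z0, 0%N).
pose B x n := label x (node x n).
exists B.
have nodeU x n : ~ U (node x n).1.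
  by elim: n => //= n IH; have [_ /(_ (label x (node x n)))[]] := Hst _ IH.
split.
  move=> x n Xx.
  have [m Hm] : exists m, forall x', agree m x x' ->
      node x n = node x' n /\ agree n (B x) (B x').
    elim: n => [|n [m IH]]; first by exists 0%N.
    have [nXpt _] := Hst _ (nodeU x n).
    have xpt : x <> pt (node x n) by move=> e; apply: nXpt; rewrite -/(pt _) -e.
    have [k _ kx] : exists2 k, (0 <= k)%N & split_at k x (pt (node x n)).
      by apply: split_at_ex xpt _ => i.
    exists (maxn m k.+1) => x' xx'.
    have [|nxx' Bxx'] := IH x'.
      by move=> i im; apply: xx'; rewrite leq_max im.
    have BB : B x n = B x' n.
      rewrite /B /label -nxx' (deltaP kx) (@deltaP k x')//.
      apply: (agree_split_at kx) => i ik; apply: xx'; by rewrite leq_max ik orbT.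
    split; first by rewrite /= -[label x _]/(B x n) -[label x' _]/(B x' n) -BB nxx'.
    by move=> i; rewrite ltnS leq_eqVlt => /orP[/eqP->//|]; exact: Bxx'.
  by exists m => x' /Hm[].
move=> b; pose nod := fix nod n := if n is m.+1 then child (nod m) (b m) else (z0, 0%N).
have nodU n : ~ U (nod n).1.
  by elim: n => //= n IH; have [_ /(_ (b n))[]] := Hst _ IH.
have nodlt n : ((nod n).2 < (nod n.+1).2)%N.
  by have [_ /(_ (b n))[]] := Hst _ (nodU n).
have nodle n : (n <= (nod n).2)%N by elim: n => // n IH; exact: leq_ltn_trans (nodlt n).
have nodmono n k : (nod n).2 <= (nod (k + n)).2.
  by elim: k => // k IH; exact: leq_trans (ltnW (nodlt (k + n))).
have nodagree n k : agree (nod n).2 (nod n).1 (nod (k + n)).1.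
  elim: k => // k IH i it; rewrite IH//.
  have [_ /(_ (b (k + n)))[_ _ + _]] := Hst _ (nodU (k + n)); apply.
  exact: leq_trans (nodmono n k).
(* The prefix fixed at node [i.+1] has length at least [i.+1], so coordinate [i] is already final
   there. *)
pose w : E := fun i => (nod i.+1).1 i.
have nodw n : agree (nod n).2 (nod n).1 w.
  move=> i it; rewrite /w; have [ni|ni] := leqP n i.+1.
    by rewrite -(subnK ni) -nodagree.
  by rewrite -(subnK (ltnW ni)) -nodagree//; exact: leq_trans (nodle i.+1).
have key n : node (f w) n = nod n -> B (f w) n = b n.
  move=> e; rewrite /B /label e.
  have [_ /(_ (b n))[_ _ _ /(_ w)]] := Hst _ (nodU n).
  by move=> [|k kw kb]; [exact: (nodw n.+1)|rewrite (deltaP kw)].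
exists (f w); first by exists w.
apply/funext => n; apply: (key); elim: n => //= n IH.
by rewrite -[label _ _]/(B (f w) n) key// IH.
Qed.

End baire_quotient.

(** * Transfer of the Lindelof property to the irrationals *)

Section michael_transfer.
Local Open Scope ring_scope.

(* [b] codes a compact set of irrationals: [b 0] bounds its elements, and
   [b (pickle q).+1] bounds their distance from the rational [q] away from 0. *)
Definition irr_compact (b : nat -> nat) : set R :=
  [set r | `|r| <= (b 0%N)%:R /\
    forall q : rat, ((b (choice.pickle q).+1).+1%:R)^-1 <= `|r - ratr q|].

Lemma irr_compact_irrational b r : irr_compact b r -> irrationals r.
Proof.
move=> [_ bq] [q rq]; have := bq q; rewrite rq subrr normr0.
by apply/negP; rewrite -ltNge invr_gt0 ltr0n.
Qed.

Lemma irr_compact_cover r : irrationals r -> exists b, irr_compact b r.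
Proof.
move=> ir.
pose b n := if n is m.+1 then
    if choice.unpickle m is Some q then Num.bound (`|r - ratr q|^-1) else 0%N
  else Num.bound `|r|.
exists b; split; first by apply/ltW/archi_boundP.
move=> q; rewrite /b choice.pickleK.
have rq : 0 < `|r - ratr q|.
  by rewrite normr_gt0 subr_eq0; apply/eqP => e; apply: ir; exists q.
rewrite -[leRHS]invrK lef_pV2 ?posrE ?invr_gt0 ?ltr0n//.
apply: ltW; apply: (lt_trans (archi_boundP _)); first by rewrite invr_ge0.
by rewrite ltr_nat.
Qed.

Variables (X : set cantor_space) (B : cantor_space -> nat -> nat) (M : topologicalType).
Hypothesis Bcont : forall x n, X x ->
  exists m, forall x', agree m x x' -> agree n (B x) (B x').

(** This is a tube argument over a compact interval: a real in [irr_compact (B x)] has a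
    neighbourhood inside a member of [C], and any other real of the interval is too close to some
    rational, which persists nearby. *)
Lemma irr_compact_usc (C : set (set (M * R))) :
  (forall U, C U -> open U) -> [set: M] `*` irrationals `<=` \bigcup_(U in C) U ->
  forall x (m : M), X x -> exists2 C' : set (set (M * R)), C' `<=` C /\ countable C' &
    nbhs (x, m) [set z : cantor_space * M | forall r, irr_compact (B z.1) r ->
      exists2 U, C' U & U (z.2, r)].
Proof.
move=> Co CI x m Xx.
pose sub (C0 : set (set (M * R))) := C0 `<=` C /\ countable C0.
(* With [F0] in the product filter, the near-covering form of compactness yields a countable
   subfamily along with the neighbourhood of [(x, m)]. *)
pose F0 : set_system (set (set (M * R))) := filter_from sub (fun C0 => [set C1 | C0 `<=` C1]).
have FF0 : Filter F0.
  apply: filter_from_filter; first by exists set0; split.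
  move=> C0 C1 [C0C cC0] [C1C cC1]; exists (C0 `|` C1).
    split; first by move=> U [/C0C|/C1C].
    by rewrite -bigcup2E; apply: bigcup_countable => // -[|[|i]] _.
  by move=> C2 CC2; split=> U CU; apply: CC2; [left|right].
pose K : set R := [set` `[- (B x 0%N)%:R, (B x 0%N)%:R]].
have cK : compact K by exact: segment_compact.
have FF : Filter (filter_prod F0 (nbhs (x, m))) by exact: filter_prod_filter.
have [|[P1 P2] [[C0 C0sub C0P] xmP] PP] := (@compact_near_coveringP _ K).1 cK _
    (filter_prod F0 (nbhs (x, m)))
    (fun i r => irr_compact (B i.2.1) r -> exists2 U, i.1 U & U (i.2.2, r)) FF.
  move=> r Kr; have [Br|nBr] := pselect (irr_compact (B x) r).
    have [//|U CU Ur] := CI (m, r); first by split => //; exact: irr_compact_irrational Br.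
    have [[V W] /= [mV rW] VW] : nbhs (m, r) U by apply: open_nbhs_nbhs; split => //; exact: Co.
    exists (W, [set i | i.1 U /\ V i.2.2]).
      split => //=; exists ([set C1 | C1 U], [set z | V z.2]) => //=.
      split; first by exists [set U] => /=; [split; [move=> _ ->|exact: countable1]|move=> C1; apply].
      by exists (setT, V) => /=; [split => //; exact: filterT|move=> z []].
    by move=> [r' i] [/= Wr' [iU Vi]] _; exists U => //; exact: VW.
  have [q rq] : exists q : rat, `|r - ratr q| < ((B x (choice.pickle q).+1).+1%:R)^-1.
    apply: contrapT => /forallNP nq; apply: nBr; split.
      by move: Kr; rewrite /K /= in_itv /= ler_norml.
    by move=> q; rewrite leNgt; apply/negP; exact: nq.
  set k := (choice.pickle q).+1 in rq.
  have [j jB] := Bcont k.+1 Xx.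
  exists ([set r' : R | `|r' - ratr q| < ((B x k).+1%:R)^-1], [set i | agree j x i.2.1]).
    split => /=.
      apply/nbhs_ballP; exists (((B x k).+1%:R)^-1 - `|r - ratr q|); first by rewrite /= subr_gt0.
      move=> r'; rewrite /ball /= ltrBrDr => rr'; apply: le_lt_trans rr'.
      by rewrite (distrC r) (_ : r' - ratr q = (r' - r) + (r - ratr q)) ?ler_normD// addrA subrK.
    exists (setT, [set z | agree j x z.1]) => /=; last by move=> [C1 z] [].
    split; first exact: filterT.
    exists ([set y : cantor_space | agree j x y], setT) => /=; last by move=> z [].
    by split; [apply/nbhs_cantor; exists j|exact: filterT].
  move=> [r' i] [/= r'q xi] [_ /(_ q)]; rewrite -/k -(jB _ xi k)//.
  by rewrite leNgt r'q.
(* Fixing coordinate 0 of [B] keeps the nearby compact sets inside the interval [K]. *)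
have [j jB] := Bcont 1 Xx; exists C0 => //.
have xj : nbhs (x, m) [set z : cantor_space * M | agree j x z.1].
  exists ([set y : cantor_space | agree j x y], setT) => /=; last by move=> z [].
  by split; [apply/nbhs_cantor; exists j|exact: filterT].
apply: filterS (filterI xmP xj) => z [zP xz] r Br.
apply: (PP (C0, z)) => //; first by split => //=; exact: C0P.
by rewrite /K /= in_itv /= -ler_norml (jB _ xz 0%N)//; case: Br.
Qed.

(** The open sets over which a countable part of [C] suffices cover [X] times [M]. Countably many of
    them suffice, and surjectivity of [B] places every irrational in some [irr_compact (B x)]. *)
Lemma lindelof_transfer :
  (forall b : nat -> nat, exists2 x, X x & B x = b) ->
  lindelof (X `*` [set: M]) -> lindelof ([set: M] `*` irrationals).
Proof.
move=> Bsurj lXM C Co CI.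
pose good (W : set (cantor_space * M)) (C' : set (set (M * R))) :=
  [/\ C' `<=` C, countable C' & forall z r, W z -> irr_compact (B z.1) r ->
    exists2 U, C' U & U (z.2, r)].
have [W [Wo _] | | WW [WWg cWW] cov] := lXM [set W | open W /\ exists C', good W C'] => //.
  move=> [x m] [/= Xx _].
  have [C' [C'C cC'] xmC'] := irr_compact_usc Co CI m Xx.
  exists (interior [set z : cantor_space * M | forall r, irr_compact (B z.1) r ->
      exists2 U, C' U & U (z.2, r)]) => //.
  split; first exact: open_interior.
  by exists C'; split => // z r /interior_subset; apply.
have /choice[c Hc] : forall W, exists C', WW W -> good W C'.
  move=> W; have [WWW|nW] := pselect (WW W); last by exists set0.
  by have [_ [C' gC']] := WWg _ WWW; exists C'.
exists (\bigcup_(W in WW) c W).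
  split; first by move=> U [W /Hc[cC _ _]] /cC.
  by apply: bigcup_countable => // W /Hc[].
move=> [m r] [_ /= /irr_compact_cover[b br]].
have [x Xx xb] := Bsurj b.
have [//|W WWW Wxm] := cov (x, m).
have [_ _ /(_ _ r Wxm)] := Hc _ WWW.
by rewrite xb => /(_ br)[U cU Ur]; exists U => //; exists W.
Qed.

End michael_transfer.

(** * The dichotomy on covering [X] by aleph_1 compact subsets *)

Theorem theorem5p7 :
  (forall (D : Type), has_card_aleph1 D ->
     forall F : D -> set cantor_space, (forall i, meager (F i)) ->
       \bigcup_(i in [set: D]) F i <> [set: cantor_space]) ->
  (exists M : topologicalType, michael_space M) ->
  forall X : set cantor_space,
    productively_lindelof X -> aleph1_analytic X -> sigma_compact X.
Proof.
move=> covM [M [lM nlMP]] X plX [D [aD [f [cf fX]]]].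
have [le [le_total le_trans le_countable]] := aleph1_order aD.
have [[F iF XF]|nF] := pselect (exists2 F, inner f F &
    forall x, range f x -> exists d n, F d n x).
  rewrite fX in XF; apply: (aleph1_compact_sigma_compact le_total le_countable aD.1
    (covM D aD) plX (F := F)) => // d n; first by case: (iF d n).
  by rewrite -fX; case: (iF d n).
have [B [Bcont Bsurj]] := baire_quotient le_total le_trans le_countable cf nF.
rewrite fX in Bcont Bsurj.
case: nlMP; exact: lindelof_transfer Bcont Bsurj (plX M lM).
Qed.
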